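(* Let $n\ge1$. The class of $(\langle\ \rangle;,\mathsf A_1,\dots,\mathsf A_n,\mathsf F_1,\dots,\mathsf F_n,\sqcup)$-algebras that are representable by $n$-ary partial functions is a quasivariety, finitely axiomatised by the following (quasi)equations (each universally quantified over all element variables occurring in it): (1) $\langle \boldsymbol a; b_1,\dots,\boldsymbol a; b_n\rangle ; c = \boldsymbol a;(\boldsymbol b; c)$; (2) $\boldsymbol\pi; a = a$; (3) $\langle \mathsf A_1^n a\rangle; a = 0$ (i.e. $\langle \mathsf A_1^n a\rangle; a=\langle \mathsf A_1^n b\rangle; b$ for all $a,b$, so that $0$ is a well-defined constant); (4) $\langle a_1,\dots,a_{i-1},0,a_{i+1},\dots,a_n\rangle; b = 0$ for every $i$; (5) $\boldsymbol a; 0 = 0$; (6) $\boldsymbol a;\mathsf A_i b = \langle \mathsf A_1^n(\boldsymbol a; b)\rangle;\langle \mathsf D_1^n a_1\rangle;\cdots;\langle \mathsf D_1^n a_n\rangle; a_i$ for every $i$; (7) $\langle \mathsf D_1^n a\rangle; b=\langle \mathsf D_1^n a\rangle; c \ \wedge\ \langle \mathsf A_1^n a\rangle; b=\langle \mathsf A_1^n a\rangle; c \ \rightarrow\ b=c$; (8) $\langle \mathsf D_1^n a\rangle; a = a$; (9) $\mathsf A_i\mathsf A_j a=\mathsf A_i\mathsf A_k a$ for every $i,j,k$; (10) $\langle \mathsf D_1^n a\rangle;(a\sqcup b)=a$; (11) $\langle \mathsf A_1^n a\rangle;(a\sqcup b)=\langle \mathsf A_1^n a\rangle; b$; (12) $\mathsf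 D_i(\mathsf F_i a)=\mathsf F_i a$ for every $i$; (13) $\langle \mathsf D_1^n(\mathsf F_i a)\rangle; a=\mathsf F_i a$ for every $i$; (14) $\boldsymbol b; a=b_i\ \rightarrow\ \boldsymbol b;\mathsf F_i a=b_i$ for every $i$.
   Context: Fix $n\ge 1$; indices $i,j,k$ range over $\{1,\dots,n\}$. The signature has an $(n+1)$-ary operation (composition), written $\langle a_1,\dots,a_n\rangle ; b$, unary operations $\mathsf A_1,\dots,\mathsf A_n,\mathsf F_1,\dots,\mathsf F_n$, and a binary operation $\sqcup$. Algebras are nonempty. An $n$-ary partial function on a set $X$ is a set $f\subseteq X^{n+1}$ such that $(\boldsymbol x,y),(\boldsymbol x,z)\in f$ implies $y=z$ (where $\boldsymbol x\in X^n$). An algebra of $n$-ary partial functions of this signature is an algebra whose elements are $n$-ary partial functions, for which there are a set $X$ (the base) and an equivalence relation $E$ on $X$ such that every tuple $(x_1,\dots,x_{n+1})$ in every element lies in $X^{n+1}$ and has pairwise $E$-equivalent entries, and whose operations are $\boldsymbol f; g=\{(\boldsymbol x,z)\in X^{n+1} : \exists \boldsymbol y\in X^n,\ (\boldsymbol x,y_i)\in f_i \text{ for each } i \text{ and } (\boldsymbol y,z)\in g\}$, $\mathsf A_i(f)=\{(\boldsymbol x,x_i)\in X^{n+1} : x_1,\dots,x_n \text{ all } E\text{-equivalent and there is no } y\in X \text{ with } (\boldsymbol x,y)\in f\}$, $\mathsf F_i(f)=\{(\boldsymbol x,x_i)\in X^{n+1} : (\boldsymbol x,x_i)\in f\}$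 (fixset), and preferential union: $(f\sqcup g)(\boldsymbol x)$ is $f(\boldsymbol x)$ if $f(\boldsymbol x)$ is defined, $g(\boldsymbol x)$ if $f(\boldsymbol x)$ is undefined but $g(\boldsymbol x)$ is defined, and undefined otherwise. An algebra is representable by $n$-ary partial functions if it is isomorphic to an algebra of $n$-ary partial functions of the same signature. Notation: a bold symbol $\boldsymbol a$ in a term $\boldsymbol a; b$ stands for $\langle a_1,\dots,a_n\rangle$; unbracketed compositions associate to the right ($\boldsymbol a;\boldsymbol b; c=\boldsymbol a;(\boldsymbol b; c)$); for unary operations $\mathsf B_1,\dots,\mathsf B_n$, $\langle \mathsf B_1^n a\rangle$ means $\langle \mathsf B_1 a,\dots,\mathsf B_n a\rangle$. Abbreviations: $0:=\langle \mathsf A_1^n b\rangle; b$ for any $b$; $\pi_i:=\mathsf A_i 0$; $\boldsymbol\pi:=\langle\pi_1,\dots,\pi_n\rangle$; $\mathsf D_i a:=\mathsf A_i\mathsf A_i a$. *)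

(* Defs.v *)
From mathcomp Require Import all_boot.
From mathcomp Require Import boolp classical_sets.
From Stdlib Require List.
From Stdlib Require Import RelationClasses.

Set Implicit Arguments.
Unset Strict Implicit.
Unset Printing Implicit Defensive.

Local Open Scope classical_set_scope.

(* [comp a b] is <a_1, ..., a_n> ; b, with the indices 1, ..., n rendered as
   the elements of 'I_n. *)
Record algebra (n : nat) := Algebra {
  carrier :> Type;
  comp : ('I_n -> carrier) -> carrier -> carrier;
  antidom : 'I_n -> carrier -> carrier;
  fixset : 'I_n -> carrier -> carrier;
  punion : carrier -> carrier -> carrier;
  carrier_nonempty : inhabited carrier }.

Arguments comp {n a}.
Arguments antidom {n a}.
Arguments fixset {n a}.
Arguments punion {n a}.

Definition is_hom (n : nat) (A B : algebra n) (h : A -> B) : Prop :=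
  [/\ forall (a : 'I_n -> A) (b : A),
        h (comp a b) = comp (fun i => h (a i)) (h b),
      forall (i : 'I_n) (a : A), h (antidom i a) = antidom i (h a),
      forall (i : 'I_n) (a : A), h (fixset i a) = fixset i (h a)
    & forall a b : A, h (punion a b) = punion (h a) (h b)].

Definition isomorphic (n : nat) (A B : algebra n) : Prop :=
  exists h : A -> B, is_hom h /\ bijective h.

(* Subsets of X^(n+1), with X^(n+1) split as X^n * X. *)
Definition graph (n : nat) (X : Type) : Type := set (('I_n -> X) * X).

Definition is_pfun (n : nat) (X : Type) (f : graph n X) : Prop :=
  forall (x : 'I_n -> X) (y z : X), f (x, y) -> f (x, z) -> y = z.

Definition undefined_at (n : nat) (X : Type) (f : graph n X)
    (x : 'I_n -> X) : Prop :=
  ~ exists y : X, f (x, y).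

Definition all_equiv (n : nat) (X : Type) (E : X -> X -> Prop)
    (x : 'I_n -> X) : Prop :=
  forall i j : 'I_n, E (x i) (x j).

Definition graph_comp (n : nat) (X : Type) (f : 'I_n -> graph n X)
    (g : graph n X) : graph n X :=
  [set p | exists y : 'I_n -> X, (forall i, f i (p.1, y i)) /\ g (y, p.2)].

Definition graph_antidom (n : nat) (X : Type) (E : X -> X -> Prop)
    (i : 'I_n) (f : graph n X) : graph n X :=
  [set p | [/\ p.2 = p.1 i, all_equiv E p.1 & undefined_at f p.1]].

Definition graph_fixset (n : nat) (X : Type) (i : 'I_n) (f : graph n X) :
    graph n X :=
  [set p | p.2 = p.1 i /\ f (p.1, p.1 i)].

Definition graph_punion (n : nat) (X : Type) (f g : graph n X) : graph n X :=
  [set p | f p \/ (undefined_at f p.1 /\ g p)].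

Record pfun_algebra (n : nat) := PfunAlgebra {
  base : Type;
  base_rel : base -> base -> Prop;
  base_rel_equiv : Equivalence base_rel;
  elts : set (graph n base);
  elts_nonempty : exists f, elts f;
  elts_pfun : forall f, elts f -> is_pfun f;
  elts_rel : forall f, elts f -> forall x y, f (x, y) ->
    all_equiv base_rel x /\ (forall i, base_rel (x i) y);
  elts_comp : forall f g, (forall i, elts (f i)) -> elts g ->
    elts (graph_comp f g);
  elts_antidom : forall i f, elts f -> elts (graph_antidom base_rel i f);
  elts_fixset : forall i f, elts f -> elts (graph_fixset i f);
  elts_punion : forall f g, elts f -> elts g -> elts (graph_punion f g) }.

Lemma pfun_algebra_inhabited (n : nat) (P : pfun_algebra n) :
  inhabited {f : graph n (base P) | elts f}.
Proof. by have [f Pf] := elts_nonempty P; exact: (inhabits (exist _ f Pf)). Qed.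

Definition algebra_of (n : nat) (P : pfun_algebra n) : algebra n :=
  @Algebra n {f : graph n (base P) | elts f}
    (fun a b => exist _ _
       (elts_comp (fun i => proj2_sig (a i)) (proj2_sig b)))
    (fun i a => exist _ _ (elts_antidom i (proj2_sig a)))
    (fun i a => exist _ _ (elts_fixset i (proj2_sig a)))
    (fun a b => exist _ _ (elts_punion (proj2_sig a) (proj2_sig b)))
    (pfun_algebra_inhabited P).

Definition representable (n : nat) (A : algebra n) : Prop :=
  exists P : pfun_algebra n, isomorphic A (algebra_of P).

Inductive term (n : nat) : Type :=
| Var of nat
| Comp of ('I_n -> term n) & term n
| Antidom of 'I_n & term n
| Fixset of 'I_n & term n
| Punion of term n & term n.

Arguments Var {n}.

Fixpoint eval (n : nat) (A : algebra n) (v : nat -> A) (t : term n) : A :=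
  match t with
  | Var m => v m
  | Comp a b => comp (fun i => eval v (a i)) (eval v b)
  | Antidom i a => antidom i (eval v a)
  | Fixset i a => fixset i (eval v a)
  | Punion a b => punion (eval v a) (eval v b)
  end.

Record equation (n : nat) := Equation { lhs : term n; rhs : term n }.

Record quasiequation (n : nat) :=
  Quasiequation { premises : seq (equation n); conclusion : equation n }.

Definition eqn_holds (n : nat) (A : algebra n) (v : nat -> A)
    (e : equation n) : Prop :=
  eval v (lhs e) = eval v (rhs e).

Definition satisfies (n : nat) (A : algebra n) (q : quasiequation n) : Prop :=
  forall v : nat -> A,
    (forall e, List.In e (premises q) -> eqn_holds v e) ->
    eqn_holds v (conclusion q).

Definition axiomatised_by (n : nat) (K : algebra n -> Prop)
    (Q : set (quasiequation n)) : Prop :=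
  forall A : algebra n, K A <-> (forall q, Q q -> satisfies A q).

Definition quasivariety (n : nat) (K : algebra n -> Prop) : Prop :=
  exists Q : set (quasiequation n), axiomatised_by K Q.

Definition finitely_axiomatised_by (n : nat) (K : algebra n -> Prop)
    (s : seq (quasiequation n)) : Prop :=
  axiomatised_by K [set q | List.In q s].

Declare Scope axiom_scope.
Delimit Scope axiom_scope with ax.
Notation "s =~ t" := (Quasiequation [::] (Equation s t)) (at level 70) :
  axiom_scope.
Notation "a ;; b" := (Comp a b) (at level 39, right associativity) :
  axiom_scope.
Local Open Scope axiom_scope.

(* The tuples <A_1 t, ..., A_n t> and <D_1 t, ..., D_n t>. *)
Definition Antidoms (n : nat) (t : term n) : 'I_n -> term n :=
  fun i => Antidom i t.

Definition Dom (n : nat) (i : 'I_n) (t : term n) : term n :=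
  Antidom i (Antidom i t).

Definition Doms (n : nat) (t : term n) : 'I_n -> term n :=
  fun i => Dom i t.

(* 0 is an abbreviation for <A_1 z, ..., A_n z> ; z for an arbitrary z.  In an
   axiom mentioning 0, z is a variable with no other occurrence in the axiom,
   hence universally quantified; the value of 0 is independent of it by
   [ax_zero]. *)
Definition Zero (n : nat) (z : term n) : term n := Antidoms z ;; z.

Definition Pi (n : nat) (z : term n) : 'I_n -> term n :=
  fun i => Antidom i (Zero z).

(* Pairwise distinct variables: two n-tuples, three single elements, and the
   variable reserved for 0. *)
Definition va (n : nat) : 'I_n -> term n := fun i => Var i.
Definition vb (n : nat) : 'I_n -> term n := fun i => Var (n + i).
Definition a0 (n : nat) : term n := Var (n + n).
Definition b0 (n : nat) : term n := Var (n + n).+1.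
Definition c0 (n : nat) : term n := Var (n + n).+2.
Definition z0 (n : nat) : term n := Var (n + n).+3.

Definition ax_assoc (n : nat) : quasiequation n :=
  (fun i => @va n ;; @vb n i) ;; c0 n =~ @va n ;; @vb n ;; c0 n.

Definition ax_proj (n : nat) : quasiequation n :=
  Pi (z0 n) ;; a0 n =~ a0 n.

Definition ax_zero (n : nat) : quasiequation n :=
  Antidoms (a0 n) ;; a0 n =~ Antidoms (b0 n) ;; b0 n.

Definition ax_comp_zero_l (n : nat) (i : 'I_n) : quasiequation n :=
  (fun j => if j == i then Zero (z0 n) else va j) ;; b0 n =~ Zero (z0 n).

Definition ax_comp_zero_r (n : nat) : quasiequation n :=
  @va n ;; Zero (z0 n) =~ Zero (z0 n).

Definition ax_comp_antidom (n : nat) (i : 'I_n) : quasiequation n :=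
  @va n ;; Antidom i (b0 n) =~
  Antidoms (@va n ;; b0 n) ;;
    foldr (fun j t => Doms (va j) ;; t) (va i) (enum 'I_n).

Definition ax_cases (n : nat) : quasiequation n :=
  Quasiequation
    [:: Equation (Doms (a0 n) ;; b0 n) (Doms (a0 n) ;; c0 n);
        Equation (Antidoms (a0 n) ;; b0 n) (Antidoms (a0 n) ;; c0 n)]
    (Equation (b0 n) (c0 n)).

Definition ax_dom (n : nat) : quasiequation n :=
  Doms (a0 n) ;; a0 n =~ a0 n.

Definition ax_antidom_antidom (n : nat) (i j k : 'I_n) : quasiequation n :=
  Antidom i (Antidom j (a0 n)) =~ Antidom i (Antidom k (a0 n)).

Definition ax_dom_punion (n : nat) : quasiequation n :=
  Doms (a0 n) ;; Punion (a0 n) (b0 n) =~ a0 n.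

Definition ax_antidom_punion (n : nat) : quasiequation n :=
  Antidoms (a0 n) ;; Punion (a0 n) (b0 n) =~ Antidoms (a0 n) ;; b0 n.

Definition ax_dom_fixset (n : nat) (i : 'I_n) : quasiequation n :=
  Dom i (Fixset i (a0 n)) =~ Fixset i (a0 n).

Definition ax_fixset_restrict (n : nat) (i : 'I_n) : quasiequation n :=
  Doms (Fixset i (a0 n)) ;; a0 n =~ Fixset i (a0 n).

Definition ax_fixset_intro (n : nat) (i : 'I_n) : quasiequation n :=
  Quasiequation
    [:: Equation (@vb n ;; a0 n) (vb i)]
    (Equation (@vb n ;; Fixset i (a0 n)) (vb i)).

Definition axioms (n : nat) : seq (quasiequation n) :=
  [:: ax_assoc n; ax_proj n; ax_zero n]
  ++ [seq ax_comp_zero_l i | i : 'I_n]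
  ++ [:: ax_comp_zero_r n]
  ++ [seq ax_comp_antidom i | i : 'I_n]
  ++ [:: ax_cases n; ax_dom n]
  ++ [seq ax_antidom_antidom p.1.1 p.1.2 p.2 | p : 'I_n * 'I_n * 'I_n]
  ++ [:: ax_dom_punion n; ax_antidom_punion n]
  ++ [seq ax_dom_fixset i | i : 'I_n]
  ++ [seq ax_fixset_restrict i | i : 'I_n]
  ++ [seq ax_fixset_intro i | i : 'I_n].

(* Main.v *)
From mathcomp Require Import all_boot.
From mathcomp Require Import boolp classical_sets.
From Stdlib Require List.
From Stdlib Require Import RelationClasses.
Require Import Defs.

Set Implicit Arguments.
Unset Strict Implicit.
Unset Printing Implicit Defensive.

Local Notation "a ;; b" := (comp a b) (at level 39, right associativity).

(** Soundness is a pointwise check. In an algebra of partial functions the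
    tuples <A_1 a, ..., A_n a> and <D_1 a, ..., D_n a> act by restricting a
    function to the points where a is undefined, respectively defined
    ([gr_antis], [gr_doms]), and the axioms become statements about where
    functions are defined and what their values are.

    For completeness, call the operators x |-> <A_1 a, ..., A_n a> ; x
    tests. The axioms make them commuting idempotents ([antis_comm],
    [antis_idem]) that annihilate the complementary restriction to the
    domain of a ([doms_antis_comp]), and [eq_by_cases] says that an element
    is determined by its restrictions to complementary tests. A set F of
    elements plays the part of a filter of tests: two elements agree modulo
    F when finitely many tests of members of F make them equal.
    Associativity makes this compatible with composition in the arguments
    ([agree_comp]). If b and c differ, a maximal F modulo which they still
    disagree contains d or A_k d for every d, by [eq_by_cases] again
    ([prime_separation]).

    Modulo such a prime F each element is either dead, meaning in agreement
    with 0, or unaffected by restriction to its domain ([dead_agree_antis],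
    [alive_agree_doms]). The classes of the elements that are not dead are
    the points contributed by F, and f acts as the partial function ([a_1],
    ..., [a_n]) |-> [<a_1, ..., a_n> ; f], undefined when the value is
    dead. This is right translation, as in Cayley's theorem. The base is
    the disjoint union over all prime F, two points being related when they
    come from the same F. The law [comp_antidom] gives antidomain the
    correct value ([dead_comp_antidom], [alive_comp_antidom]);
    [doms_punion] and [antis_punion] do so for preferential union, and
    [dom_fixset], [doms_fixset] and [fixset_intro] for fixset. Distinct b
    and c are told apart by a separating F at the point tuple ([pi_1], ...,
    [pi_n]), because pi ; a = a ([repr_inj]). *)

(** * The axioms as laws of an algebra *)

Definition antis (n : nat) (A : algebra n) (a : A) : 'I_n -> A :=
  fun i => antidom i a.

Definition doms (n : nat) (A : algebra n) (a : A) : 'I_n -> A :=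
  fun i => antidom i (antidom i a).

(** The axioms read as statements about elements, with 0 named once and for all
    by [o]. *)
Record laws (n : nat) (A : algebra n) (o : A) : Prop := {
  comp_assoc : forall (a b : 'I_n -> A) (c : A),
    (fun i => a ;; b i) ;; c = a ;; b ;; c;
  proj_comp : forall a : A, antis o ;; a = a;
  antis_comp_self : forall a : A, antis a ;; a = o;
  comp_zero_l : forall (i : 'I_n) (a : 'I_n -> A) (b : A),
    a i = o -> a ;; b = o;
  comp_zero_r : forall a : 'I_n -> A, a ;; o = o;
  comp_antidom : forall (i : 'I_n) (a : 'I_n -> A) (b : A),
    a ;; antidom i b =
    antis (a ;; b) ;; foldr (fun j t => doms (a j) ;; t) (a i) (enum 'I_n);
  eq_by_cases : forall a b c : A,
    doms a ;; b = doms a ;; c -> antis a ;; b = antis a ;; c -> b = c;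
  doms_comp_self : forall a : A, doms a ;; a = a;
  antidom_antidom : forall (i j k : 'I_n) (a : A),
    antidom i (antidom j a) = antidom i (antidom k a);
  doms_punion : forall a b : A, doms a ;; punion a b = a;
  antis_punion : forall a b : A, antis a ;; punion a b = antis a ;; b;
  dom_fixset : forall (i : 'I_n) (a : A), doms (fixset i a) i = fixset i a;
  doms_fixset : forall (i : 'I_n) (a : A),
    doms (fixset i a) ;; a = fixset i a;
  fixset_intro : forall (i : 'I_n) (b : 'I_n -> A) (a : A),
    b ;; a = b i -> b ;; fixset i a = b i }.

Lemma forall_In_cat (T : Type) (P : T -> Prop) (s t : seq T) :
  (forall q, List.In q (s ++ t) -> P q) <->
  (forall q, List.In q s -> P q) /\ (forall q, List.In q t -> P q).
Proof.
split=> [H | [Hs Ht] q /List.in_app_iff [/Hs | /Ht] //].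
by split=> q Hq; apply: H; apply/List.in_app_iff; [left | right].
Qed.

Lemma forall_In_cons (T : Type) (P : T -> Prop) (x : T) (s : seq T) :
  (forall q, List.In q (x :: s) -> P q) <->
  P x /\ (forall q, List.In q s -> P q).
Proof.
split=> [H | [Hx Hs] q [<- // | /Hs //]].
by split=> [|q Hq]; apply: H; [left | right].
Qed.

Lemma forall_In_image (T : Type) (I : finType) (P : T -> Prop) (f : I -> T) :
  (forall q, List.In q [seq f i | i : I] -> P q) <-> (forall i, P (f i)).
Proof.
rewrite /image_mem; split=> [H i | H].
- apply: H; have: i \in enum I by rewrite mem_enum.
  elim: (enum I) => //= j s IHs; rewrite inE.
  by case/orP=> [/eqP-> | /IHs]; [left | right].
- by elim: (enum I) => //= j s IHs q [<- // | /IHs].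
Qed.

Lemma axiomsP (n : nat) (P : quasiequation n -> Prop) :
  (forall q, List.In q (axioms n) -> P q) <->
  P (ax_assoc n) /\ P (ax_proj n) /\ P (ax_zero n) /\
  (forall i, P (ax_comp_zero_l i)) /\ P (ax_comp_zero_r n) /\
  (forall i, P (ax_comp_antidom i)) /\ P (ax_cases n) /\ P (ax_dom n) /\
  (forall p : 'I_n * 'I_n * 'I_n, P (ax_antidom_antidom p.1.1 p.1.2 p.2)) /\
  P (ax_dom_punion n) /\ P (ax_antidom_punion n) /\
  (forall i, P (ax_dom_fixset i)) /\ (forall i, P (ax_fixset_restrict i)) /\
  (forall i, P (ax_fixset_intro i)).
Proof.
rewrite /axioms !(propext (forall_In_cat _ _ _)).
rewrite !(propext (forall_In_cons _ _ _)).
rewrite !(propext (forall_In_image _ _)) /=.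
split; first by move=> H; decompose [and] H; do ! split.
by move=> H; decompose [and] H; do ! split.
Qed.

(** Lets a law about arbitrary elements be read off from the corresponding
    axiom by choosing the values of its variables. *)
Lemma assignment (n : nat) (A : Type) (a b : 'I_n -> A) (x y z w : A) :
  exists v : nat -> A,
    a = (fun i => v i) /\ b = (fun i => v (n + i)) /\
    x = v (n + n) /\ y = v (n + n).+1 /\ z = v (n + n).+2 /\
    w = v (n + n).+3.
Proof.
pose v m := if insub m is Some i then a i
  else if insub (m - n) is Some i then b i
  else nth w [:: x; y; z] (m - (n + n)).
have vE k : v (n + n + k) = nth w [:: x; y; z] k.
  have geN m : ~~ (n + m < n) by rewrite -leqNgt leq_addr.
  by rewrite /v -addnA insubN // addKn insubN // addnA addKn.
exists v; split; first by apply/funext => i; rewrite /v valK.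
split.
  apply/funext => i; rewrite /v insubN; last by rewrite -leqNgt leq_addr.
  by rewrite addKn valK.
have := (vE 0, vE 1, vE 2, vE 3).
by rewrite addn0 addn1 addn2 addn3 => -[[[-> ->] ->] ->].
Qed.

Lemma eval_foldr_comp (n : nat) (A : algebra n) (v : nat -> A)
    (f : 'I_n -> 'I_n -> term n) (t : term n) (s : seq 'I_n) :
  eval v (foldr (fun j u => Comp (f j) u) t s) =
  foldr (fun j x => (fun i => eval v (f j i)) ;; x) (eval v t) s.
Proof. by elim: s => //= j s ->. Qed.

(** The passage between quasiequations about terms and laws about elements, in
    both directions: soundness builds the right-hand side, completeness
    consumes it. *)
Lemma satisfies_axiomsP (n : nat) (A : algebra n) :
  (forall q, List.In q (axioms n) -> satisfies A q) <->
  exists o : A, laws o.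
Proof.
rewrite axiomsP; split.
- case=> H1 [H2 [H3 [H4 [H5 [H6 [H7 [H8 [H9 [H10 [H11 [H12 [H13 H14]]]]]]]]]]]].
  have [w] := carrier_nonempty A; exists (antis w ;; w); split.
  + move=> a b c.
    have [v [-> [-> [_ [_ [-> _]]]]]] := assignment a b c c c c.
    exact: (H1 v).
  + move=> a; have [v [_ [_ [-> [_ [_ ->]]]]]] :=
      assignment (antis a) (antis a) a a a w.
    exact: (H2 v).
  + move=> a; have [v [_ [_ [-> [-> _]]]]] :=
      assignment (antis a) (antis a) a w w w.
    exact: (H3 v).
  + move=> i a b; have [v [aE [_ [_ [-> [_ ->]]]]]] := assignment a a b b b w.
    move=> ai; rewrite -[RHS](H4 i v) //=; congr Defs.comp; apply/funext => j.
    by case: eqP => [-> // | _]; rewrite aE.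
  + move=> a; have [v [-> [_ [_ [_ [_ ->]]]]]] := assignment a a w w w w.
    exact: (H5 v).
  + move=> i a b; have [v [-> [_ [_ [-> [_ _]]]]]] := assignment a a b b b b.
    have := H6 i v; rewrite /satisfies /eqn_holds /= eval_foldr_comp.
    exact.
  + move=> a b c; have [v [_ [_ [-> [-> [-> _]]]]]] :=
      assignment (antis a) (antis a) a b c c.
    by move=> e1 e2; apply: (H7 v) => e [<- // | [<- // | []]].
  + move=> a; have [v [_ [_ [-> _]]]] := assignment (antis a) (antis a) a a a a.
    exact: (H8 v).
  + move=> i j k a.
    have [v [_ [_ [-> _]]]] := assignment (antis a) (antis a) a a a a.
    exact: (H9 (i, j, k) v).
  + move=> a b; have [v [_ [_ [-> [-> _]]]]] :=
      assignment (antis a) (antis a) a b b b.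
    exact: (H10 v).
  + move=> a b; have [v [_ [_ [-> [-> _]]]]] :=
      assignment (antis a) (antis a) a b b b.
    exact: (H11 v).
  + move=> i a.
    have [v [_ [_ [-> _]]]] := assignment (antis a) (antis a) a a a a.
    exact: (H12 i v).
  + move=> i a.
    have [v [_ [_ [-> _]]]] := assignment (antis a) (antis a) a a a a.
    exact: (H13 i v).
  + move=> i b a; have [v [_ [-> [-> _]]]] := assignment b b a a a a.
    by move=> e; apply: (H14 i v) => _ [<- // | []].
- case=> o L.
  have zE (v : nat -> A) : eval v (Zero (z0 n)) = o.
    exact: (antis_comp_self L).
  refine (conj _ (conj _ (conj _ (conj _ (conj _ (conj _ (conj _ (conj _
    (conj _ (conj _ (conj _ (conj _ (conj _ _))))))))))))).
  + by move=> v _; exact: (comp_assoc L).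
  + move=> v _; rewrite /eqn_holds /=.
    rewrite -[RHS](proj_comp L); congr Defs.comp; apply/funext => i.
    by rewrite /Pi /= (antis_comp_self L).
  + by move=> v _; rewrite /eqn_holds /= !(antis_comp_self L).
  + move=> i v _; rewrite /eqn_holds zE /=.
    by apply: (comp_zero_l L (i := i)); rewrite eqxx zE.
  + move=> v _; rewrite /eqn_holds /= -!/(antis _) (antis_comp_self L).
    exact: (comp_zero_r L).
  + move=> i v _; rewrite /eqn_holds /= eval_foldr_comp.
    exact: (comp_antidom L).
  + move=> v H; apply: (eq_by_cases L (a := v (n + n))).
      exact: (H _ (or_introl erefl)).
    exact: (H _ (or_intror (or_introl erefl))).
  + by move=> v _; exact: (doms_comp_self L).
  + by move=> p v _; exact: (antidom_antidom L).
  + by move=> v _; exact: (doms_punion L).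
  + by move=> v _; exact: (antis_punion L).
  + by move=> i v _; exact: (dom_fixset L).
  + by move=> i v _; exact: (doms_fixset L).
  + move=> i v H; apply: (fixset_intro L).
    exact: (H _ (or_introl erefl)).
Qed.

Lemma eval_hom (n : nat) (A B : algebra n) (h : A -> B) (v : nat -> A)
    (t : term n) : is_hom h -> h (eval v t) = eval (h \o v) t.
Proof.
case=> hc ha hf hp; elim: t => //=.
- by move=> a IHa b IHb; rewrite hc IHb; congr Defs.comp; apply/funext => i.
- by move=> i a IHa; rewrite ha IHa.
- by move=> i a IHa; rewrite hf IHa.
- by move=> a IHa b IHb; rewrite hp IHa IHb.
Qed.

(** Injectivity of the isomorphism reflects equations and the homomorphism
    property transports premises, so quasiequations pass back along it. *)
Lemma satisfies_isomorphic (n : nat) (A B : algebra n) (q : quasiequation n) :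
  isomorphic A B -> satisfies B q -> satisfies A q.
Proof.
case=> h [hh /bij_inj hI] sB v Hv; apply: hI; rewrite !(eval_hom _ _ hh).
apply: sB => e /Hv; rewrite /eqn_holds => /(congr1 h).
by rewrite !(eval_hom _ _ hh).
Qed.

(** * Soundness *)

Section Soundness.
Variables (n : nat) (k0 : 'I_n) (P : pfun_algebra n).
Local Notation A := (algebra_of P).
Local Notation E := (@base_rel n P).
Local Notation gr := (@proj1_sig (graph n (base P)) (@elts n P)).

Definition defined_at (f : A) (x : 'I_n -> base P) : Prop :=
  exists y, gr f (x, y).

(** Elements carry a membership proof; only their graphs matter. *)
Lemma pfun_ext (f g : A) :
  (forall x z, gr f (x, z) <-> gr g (x, z)) -> f = g.
Proof.
case: f g => f Pf [g Pg] /= fg.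
by apply: eq_exist; apply/predeqP => -[x z]; exact: fg.
Qed.

Lemma gr_equiv (f : A) x z : gr f (x, z) -> all_equiv E x.
Proof. by case/(elts_rel (proj2_sig f)). Qed.

Lemma gr_fun (f : A) x y z : gr f (x, y) -> gr f (x, z) -> y = z.
Proof. exact: (elts_pfun (proj2_sig f)). Qed.

(** Each value is related to all the arguments, hence the values to each other;
    this is what lets A_i be defined at a tuple of values. *)
Lemma gr_values_equiv (a : 'I_n -> A) x y :
  (forall i, gr (a i) (x, y i)) -> all_equiv E y.
Proof.
have [_ Esym Etrans] := base_rel_equiv P.
move=> axy i j; have [_ Ei] := elts_rel (proj2_sig (a i)) (axy i).
have [_ Ej] := elts_rel (proj2_sig (a j)) (axy j).
by apply: Etrans (Ej i); apply: Esym.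
Qed.

Lemma gr_comp (a : 'I_n -> A) (f : A) x z :
  gr (a ;; f) (x, z) <->
  exists y, (forall i, gr (a i) (x, y i)) /\ gr f (y, z).
Proof. by []. Qed.

Lemma gr_antidom (i : 'I_n) (f : A) x z :
  gr (antidom i f) (x, z) <->
  z = x i /\ all_equiv E x /\ ~ defined_at f x.
Proof. by split=> [[] | [? []]]. Qed.

(** Since A_i returns its i-th argument, the tuple of all A_i f acts as the
    identity where f is undefined.  An index [k0] is needed to detect that f is
    undefined, whence n > 0. *)
Lemma gr_antis (f g : A) x z :
  gr (antis f ;; g) (x, z) <-> ~ defined_at f x /\ gr g (x, z).
Proof.
split=> [/gr_comp [y [H gyz]] | [nf gxz]].
  have yx : y = x by apply/funext => i; case/gr_antidom: (H i).
  by have /gr_antidom [_ [_ nf]] := H k0; rewrite yx in gyz.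
apply/gr_comp; exists x; split=> // i.
by apply/gr_antidom; split=> //; split=> //; exact: gr_equiv gxz.
Qed.

Lemma gr_doms (f g : A) x z :
  gr (doms f ;; g) (x, z) <-> defined_at f x /\ gr g (x, z).
Proof.
have domE i y w : gr (doms f i) (y, w) <->
    w = y i /\ all_equiv E y /\ defined_at f y.
  rewrite gr_antidom; split=> -[-> [Ey fy]]; do ! split=> //.
    apply: contrapT => nf; apply: fy; exists (y i).
    by apply/gr_antidom.
  by case=> u /gr_antidom [_ [_]].
split=> [/gr_comp [y [H gyz]] | [fx gxz]].
  have yx : y = x by apply/funext => i; case/domE: (H i).
  by have /domE [_ [_ fx]] := H k0; rewrite yx in gyz.
apply/gr_comp; exists x; split=> // i.
by apply/domE; split=> //; split=> //; exact: gr_equiv gxz.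
Qed.

Lemma gr_foldr_doms (a : 'I_n -> A) (f : A) (s : seq 'I_n) x z :
  gr (foldr (fun j t => doms (a j) ;; t) f s) (x, z) <->
  (forall j, j \in s -> defined_at (a j) x) /\ gr f (x, z).
Proof.
elim: s => [|j s IHs]; first by split=> [|[]].
(* Exposes the head step of the fold as a composition, which [/=] would
   unfold down to graphs. *)
rewrite -cat1s foldr_cat [foldr _ _ [:: j]]/(_ ;; _) gr_doms IHs.
split=> [[dj [ds fz]] | [ds fz]].
  by split=> // k; rewrite inE => /predU1P [-> | /ds].
split; first by apply: ds; rewrite inE eqxx.
by split=> // k ks; apply: ds; rewrite inE ks orbT.
Qed.

Lemma gr_fixset (i : 'I_n) (f : A) x z :
  gr (fixset i f) (x, z) <-> z = x i /\ gr f (x, x i).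
Proof. by []. Qed.

Lemma gr_punion (f g : A) x z :
  gr (punion f g) (x, z) <-> gr f (x, z) \/ (~ defined_at f x /\ gr g (x, z)).
Proof. by []. Qed.

Lemma pfun_algebra_laws : exists o : A, laws o.
Proof.
have [f0] := carrier_nonempty A; exists (antis f0 ;; f0).
have no x z : ~ gr (antis f0 ;; f0) (x, z).
  by rewrite gr_antis => -[nf fz]; apply: nf; exists z.
split.
- move=> a b c; apply: pfun_ext => x z; split.
    case/gr_comp=> y [abxy cyz].
    have /choice [u Hu] : forall i, exists u, (forall j, gr (a j) (x, u j)) /\
        gr (b i) (u, y i) by move=> i; apply/gr_comp; exact: abxy.
    (* The witnesses [u i] coincide since the [a j] are single-valued. *)
    exists (u k0); split; first by case: (Hu k0).
    exists y; split=> // i.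
    suff <- : u i = u k0 by case: (Hu i).
    apply/funext => j; have [/(_ j) ai _] := Hu i; have [/(_ j) ak _] := Hu k0.
    exact: gr_fun ai ak.
  case/gr_comp=> y [axy /gr_comp [w [byw cwz]]].
  by exists w; split=> // i; exists y.
- move=> a; apply: pfun_ext => x z; rewrite gr_antis; split=> [[] // | az].
  by split=> // -[y] /no.
- move=> a; apply: pfun_ext => x z; split=> [/gr_antis [na az] | /no //].
  by case: na; exists z.
- move=> i a b ai; apply: pfun_ext => x z.
  split=> [/gr_comp [y [H _]] | /no //].
  by move: (H i); rewrite ai => /no.
- by move=> a; apply: pfun_ext => x z; split=> [/gr_comp [y [_ /no]] | /no].
- move=> i a b; apply: pfun_ext => x z.
  rewrite gr_antis gr_foldr_doms; split.
    case/gr_comp=> y [axy /gr_antidom [-> [_ nb]]]; split.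
      case=> w /gr_comp [u [axu buw]]; apply: nb; exists w.
      suff -> : y = u by [].
      by apply/funext => j; exact: gr_fun (axy j) (axu j).
    by split=> // j _; exists (y j).
  case=> nab [da aiz].
  have /choice [y axy] : forall j, exists u, gr (a j) (x, u).
    by move=> j; apply: da; rewrite mem_enum.
  apply/gr_comp; exists y; split=> //; apply/gr_antidom; split.
    exact: gr_fun aiz (axy i).
  split; first exact: gr_values_equiv axy.
  by case=> w byw; apply: nab; exists w; apply/gr_comp; exists y.
- move=> a b c eD eA; apply: pfun_ext => x z.
  have [da | na] := EM (defined_at a x).
    by have := gr_doms a b x z; rewrite eD gr_doms; tauto.
  by have := gr_antis a b x z; rewrite eA gr_antis; tauto.
- move=> a; apply: pfun_ext => x z; rewrite gr_doms; split=> [[] // | az].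
  by split=> //; exists z.
- move=> i j k a; apply: pfun_ext => x z; rewrite !gr_antidom.
  suff H j' k' : all_equiv E x -> defined_at (antidom j' a) x ->
      defined_at (antidom k' a) x.
    by split=> -[-> [Ex nd]]; do ! split=> //; move=> /(H _ _ Ex).
  by move=> Ex [y /gr_antidom [_ ?]]; exists (x k'); apply/gr_antidom.
- move=> a b; apply: pfun_ext => x z; rewrite gr_doms gr_punion.
  split=> [[da [// | [/(_ da)]]] // | az].
  by split; [exists z | left].
- move=> a b; apply: pfun_ext => x z; rewrite !gr_antis gr_punion.
  split=> [[na [az | []]] // | [na bz]]; last by split=> //; right.
  by case: na; exists z.
- move=> i a; apply: pfun_ext => x z; rewrite /doms !gr_antidom gr_fixset.
  split=> [[-> [Ex nd]] | [-> ax]].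
    split=> //; apply: contrapT => nax; apply: nd; exists (x i).
    by apply/gr_antidom; do ! split=> //; case=> w /gr_fixset [_].
  split=> //; split; first exact: gr_equiv ax.
  by case=> w /gr_antidom [_ [_]]; apply; exists (x i).
- move=> i a; apply: pfun_ext => x z; rewrite gr_doms gr_fixset.
  split=> [[[w /gr_fixset [_ ax]] az] | [-> ax]].
    by split=> //; exact: gr_fun az ax.
  by split=> //; exists (x i).
- move=> i b a e; apply: pfun_ext => x z; split.
    case/gr_comp=> y [bxy /gr_fixset [-> _]]; exact: bxy.
  rewrite -{1}e => bz; have: gr (b i) (x, z) by rewrite -e.
  case/gr_comp: bz => y [bxy ayz] bz.
  apply/gr_comp; exists y; split=> //.
  by rewrite (gr_fun bz (bxy i)) in ayz *.
Qed.

End Soundness.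

Lemma representable_satisfies (n : nat) (A : algebra n) :
  0 < n -> representable A ->
  forall q, List.In q (axioms n) -> satisfies A q.
Proof.
move=> hn [P AP] q Hq; apply: satisfies_isomorphic AP _.
by move: q Hq; apply/satisfies_axiomsP; exact: pfun_algebra_laws (Ordinal hn) P.
Qed.

(** * The calculus of antidomain tests *)

Section Tests.
Variables (n : nat) (k0 : 'I_n) (A : algebra n) (o : A) (L : laws o).
Implicit Types (a b c d f g x y : A) (i j k : 'I_n) (s t : seq A).

Lemma foldr_comp_id (e : 'I_n -> 'I_n -> A) x (js : seq 'I_n) :
  (forall j, e j ;; x = x) -> foldr (fun j y => e j ;; y) x js = x.
Proof. by move=> ex; elim: js => //= j js ->. Qed.

Lemma doms_antis k a : doms a = antis (antidom k a).
Proof. by apply/funext => i; exact: (antidom_antidom L). Qed.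

Lemma doms_antidom i j a : doms (antidom j a) = doms (antidom i a).
Proof.
by apply/funext => l; rewrite /doms (antidom_antidom L l j i).
Qed.

(** In [comp_antidom] for a tuple of antidomains, every domain restriction on
    the right-hand side is by the domain of A_i a, which fixes A_i a. *)
Lemma antis_comp_antidom a i b :
  antis a ;; antidom i b = antis (antis a ;; b) ;; antidom i a.
Proof.
rewrite (comp_antidom L) foldr_comp_id // => j.
by rewrite /antis (doms_antidom i) (doms_comp_self L).
Qed.

(** Moving a test past another restricts the latter's argument; commutation,
    idempotence and their extension to finite families all rest on this. *)
Lemma antis_swap a b x :
  antis a ;; antis b ;; x = antis (antis a ;; b) ;; antis a ;; x.
Proof.
rewrite -!(comp_assoc L); congr Defs.comp; apply/funext => i.
exact: antis_comp_antidom.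
Qed.

Lemma antis_idem a x : antis a ;; antis a ;; x = antis a ;; x.
Proof. by rewrite antis_swap (antis_comp_self L) (proj_comp L). Qed.

Lemma doms_antis_comp a x : doms a ;; antis a ;; x = o.
Proof.
rewrite -(comp_assoc L); apply: (comp_zero_l L (i := k0)).
by rewrite (doms_antis k0) (antis_comp_self L).
Qed.

(** Both sides vanish on the domain of a, and [antis_swap] makes them equal on
    its complement. *)
Lemma antis_comm a b x : antis a ;; antis b ;; x = antis b ;; antis a ;; x.
Proof.
apply: (eq_by_cases L (a := a)).
  rewrite doms_antis_comp (doms_antis k0).
  by rewrite antis_swap -doms_antis doms_antis_comp (comp_zero_r L).
by rewrite antis_idem [RHS]antis_swap antis_idem -antis_swap.
Qed.

Lemma antis_doms_comp a x : antis a ;; doms a ;; x = o.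
Proof. by rewrite (doms_antis k0) antis_comm -doms_antis doms_antis_comp. Qed.

(** Finite sequences of tests stand for their product, so that no closure of the
    tests under composition is called for. *)
Definition restrict s x := foldr (fun a y => antis a ;; y) x s.

Lemma restrict_cat s t x : restrict (s ++ t) x = restrict s (restrict t x).
Proof. exact: foldr_cat. Qed.

Lemma restrict_zero s : restrict s o = o.
Proof. by elim: s => //= a s ->; rewrite (comp_zero_r L). Qed.

Lemma restrict_antis s a x :
  restrict s (antis a ;; x) = antis a ;; restrict s x.
Proof. by elim: s => //= b s ->; rewrite antis_comm. Qed.

Lemma restrict_comm s t x :
  restrict s (restrict t x) = restrict t (restrict s x).
Proof. by elim: s => //= a s ->; rewrite restrict_antis. Qed.

Lemma restrict_comp s (a : 'I_n -> A) f :
  restrict s (a ;; f) = (fun i => restrict s (a i)) ;; f.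
Proof.
by elim: s => //= b s ->; rewrite (comp_assoc L).
Qed.

Lemma restrict_swap s a x :
  restrict s (antis a ;; x) = antis (restrict s a) ;; restrict s x.
Proof. by elim: s => //= b s ->; rewrite antis_swap. Qed.

(** An element that vanishes under a product of tests has its whole domain
    killed by it: on the support of the product A_k y becomes pi_k, so the
    restriction to the domain of y, being the test of A_k y, becomes
    restriction to the complement of the domain of pi_k, that is, 0. *)
Lemma restrict_doms_zero s y c :
  restrict s y = o -> restrict s (doms y ;; c) = o.
Proof.
move=> sy; have yE : antidom k0 y = antis y ;; antidom k0 o.
  by rewrite antis_comp_antidom (comp_zero_r L) (proj_comp L).
rewrite (doms_antis k0) restrict_swap yE restrict_swap sy (proj_comp L).
(* Now [c] is written as pi ; c, so that the test meets [restrict s] of pi. *)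
rewrite -[c](proj_comp L) restrict_comp -(comp_assoc L).
by apply: (comp_zero_l L (i := k0)); exact: (antis_comp_self L).
Qed.

(** * Agreement modulo a set of tests *)

(** [F] is a set of elements whose antidomains belong to a filter; agreement is
    equality in the quotient by that filter. *)
Definition agree (F : set A) x y : Prop :=
  exists s, (forall a, List.In a s -> F a) /\ restrict s x = restrict s y.

(** The filter decides, for each d, between the complement of the domain of d
    and the domain of d; the latter is the antidomain of A_k d.  The choice of
    k is immaterial by [antidom_antidom]. *)
Definition prime (F : set A) : Prop := forall d, F d \/ F (antidom k0 d).

Variable F : set A.

Lemma agree_refl x : agree F x x.
Proof. by exists [::]. Qed.

Lemma agree_sym x y : agree F x y -> agree F y x.
Proof. by case=> s [Fs e]; exists s. Qed.

Lemma agree_trans y x z : agree F x y -> agree F y z -> agree F x z.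
Proof.
case=> s [Fs e] [t [Ft e']]; exists (t ++ s); split; first exact/forall_In_cat.
by rewrite !restrict_cat e restrict_comm e' restrict_comm.
Qed.

Lemma agree_antis a x : F a -> agree F (antis a ;; x) x.
Proof.
move=> Fa; exists [:: a]; split; first by move=> _ [<-|[]].
exact: antis_idem.
Qed.

(** Finitely many finite products of tests have a common refinement. *)
Lemma agree_common (a b : 'I_n -> A) :
  (forall i, agree F (a i) (b i)) ->
  exists s, (forall d, List.In d s -> F d) /\
    forall i, restrict s (a i) = restrict s (b i).
Proof.
move=> ab.
suff [s [Fs H]] : exists s, (forall d, List.In d s -> F d) /\
    forall i, i \in enum 'I_n -> restrict s (a i) = restrict s (b i).
  by exists s; split=> // i; apply: H; rewrite mem_enum.
elim: (enum 'I_n) => [|i js [s [Fs H]]]; first by exists [::].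
have [t [Ft e]] := ab i; exists (s ++ t); split; first exact/forall_In_cat.
move=> j; rewrite inE !restrict_cat => /predU1P [-> | js_j]; first by rewrite e.
by rewrite restrict_comm H // restrict_comm.
Qed.

(** Tests apply to a ; f through its arguments a, by associativity. *)
Lemma agree_comp (a b : 'I_n -> A) f :
  (forall i, agree F (a i) (b i)) -> agree F (a ;; f) (b ;; f).
Proof.
case/agree_common=> s [Fs ab]; exists s; split=> //.
by rewrite !restrict_comp; congr Defs.comp; apply/funext.
Qed.

(** At the points given by [F], the element is undefined. *)
Definition dead x : Prop := agree F x o.

Lemma agree_dead x y : agree F x y -> dead x -> dead y.
Proof. by move=> /agree_sym xy; exact: agree_trans. Qed.

Lemma dead_comp (a : 'I_n -> A) f i : dead (a i) -> dead (a ;; f).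
Proof.
case=> s [Fs si]; exists s; split=> //.
rewrite restrict_comp restrict_zero; apply: (comp_zero_l L (i := i)).
by rewrite si restrict_zero.
Qed.

Lemma dead_doms x c : dead x -> dead (doms x ;; c).
Proof.
case=> s [Fs e]; exists s; split=> //.
by rewrite restrict_zero; apply: restrict_doms_zero; rewrite e restrict_zero.
Qed.

Hypothesis prF : prime F.

(** If F chooses the domain of x instead, then F decides that x is both defined
    and undefined; it is then improper and everything is dead. *)
Lemma dead_agree_antis x c : dead x -> agree F (antis x ;; c) c.
Proof.
move=> dx; have [Fx | Fx] := prF x; first exact: agree_antis.
have dc : dead c.
  apply: agree_dead (dead_doms c dx); rewrite (doms_antis k0).
  exact: agree_antis.
apply: (agree_trans _ (agree_sym dc)).
case: dc => s [Fs e]; exists s.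
by rewrite restrict_antis e restrict_zero (comp_zero_r L).
Qed.

Lemma alive_agree_doms x c : ~ dead x -> agree F (doms x ;; c) c.
Proof.
move=> nx; have [Fx | Fx] := prF x.
  case: nx; rewrite /dead -(antis_comp_self L x); exact/agree_sym/agree_antis.
by rewrite (doms_antis k0); exact: agree_antis.
Qed.

(** On arguments that are alive, the domain restrictions in [comp_antidom] have
    no effect modulo F, and neither has the test of the dead a ; f. *)
Lemma dead_comp_antidom (a : 'I_n -> A) f i :
  (forall j, ~ dead (a j)) -> dead (a ;; f) ->
  agree F (a ;; antidom i f) (a i).
Proof.
move=> na daf; rewrite (comp_antidom L).
apply: (agree_trans (dead_agree_antis _ daf)).
elim: (enum 'I_n) => [|j js IHs]; first exact: agree_refl.
exact: agree_trans (alive_agree_doms _ (na j)) IHs.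
Qed.

(** The test of a ; f on the right of [comp_antidom] meets the domain of
    a ; f. *)
Lemma alive_comp_antidom (a : 'I_n -> A) f i :
  ~ dead (a ;; f) -> dead (a ;; antidom i f).
Proof.
move=> naf; rewrite (comp_antidom L) /dead.
set c := foldr _ _ _; rewrite -(doms_antis_comp (a ;; f) c).
exact/agree_sym/alive_agree_doms.
Qed.

(** D_i f is A_i of A_i f, which is dead at [a] when f is alive there. *)
Lemma alive_comp_doms (a : 'I_n -> A) f i :
  ~ dead (a ;; f) -> agree F (a ;; doms f i) (a i).
Proof.
move=> naf; apply: dead_comp_antidom; last exact: alive_comp_antidom.
by move=> j daj; apply: naf; exact: dead_comp daj.
Qed.

(** The law [fixset_intro] applies to the tuple a restricted by the tests that
    witness the agreement. *)
Lemma agree_comp_fixset (a : 'I_n -> A) f i :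
  agree F (a ;; f) (a i) -> agree F (a ;; fixset i f) (a i).
Proof.
case=> s [Fs e]; exists s; split=> //.
by rewrite restrict_comp; apply: (fixset_intro L); rewrite -restrict_comp.
Qed.

Lemma alive_comp_fixset (a : 'I_n -> A) f i :
  ~ dead (a ;; fixset i f) ->
  agree F (a ;; fixset i f) (a ;; f) /\ agree F (a ;; fixset i f) (a i).
Proof.
move=> na; split.
  rewrite -{1}(doms_fixset L) -(comp_assoc L); apply: agree_comp => j.
  exact: alive_comp_doms.
by rewrite -{1}(dom_fixset L); exact: alive_comp_doms.
Qed.

Lemma alive_comp_punion (a : 'I_n -> A) f g :
  ~ dead (a ;; f) -> agree F (a ;; punion f g) (a ;; f).
Proof.
move=> na; rewrite -{2}(doms_punion L f g) -(comp_assoc L).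
by apply: agree_comp => i; apply/agree_sym; exact: alive_comp_doms.
Qed.

Lemma dead_comp_punion (a : 'I_n -> A) f g :
  (forall j, ~ dead (a j)) -> dead (a ;; f) ->
  agree F (a ;; punion f g) (a ;; g).
Proof.
move=> na da.
have H h : agree F (a ;; antis f ;; h) (a ;; h).
  by rewrite -(comp_assoc L); apply: agree_comp => i; exact: dead_comp_antidom.
apply: (agree_trans (agree_sym (H (punion f g)))); rewrite (antis_punion L).
exact: H.
Qed.

End Tests.

(** * Separation by prime sets of tests *)

Section Separation.
Variables (n : nat) (k0 : 'I_n) (A : algebra n) (o : A) (L : laws o).

(** Among finitely many tests, those of d can be gathered into a single one. *)
Lemma agree_add (F : set A) (d b c : A) :
  agree (F `|` [set d])%classic b c ->
  agree F (antis d ;; b) (antis d ;; c).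
Proof.
case=> s [Fs e].
suff [t [Ft tE]] : exists t, (forall a, List.In a t -> F a) /\
    forall x, restrict t (antis d ;; x) = restrict s (antis d ;; x).
  by exists t; rewrite !tE !(restrict_antis k0 L) e.
elim: s Fs {e} => [|a s IHs]; first by exists [::].
case/forall_In_cons=> Fa Fs.
have [t [Ft tE]] := IHs Fs; case: Fa => [Fa | ->].
  by exists (a :: t); split; [apply/forall_In_cons | move=> x /=; rewrite tE].
exists t; split=> // x /=.
by rewrite tE !(restrict_antis k0 L) (antis_idem L).
Qed.

(** Case analysis on d, performed inside a common product of tests. *)
Lemma agree_cases (F : set A) (d b c : A) :
  agree F (antis d ;; b) (antis d ;; c) ->
  agree F (doms d ;; b) (doms d ;; c) -> agree F b c.
Proof.
case=> s [Fs e] [t [Ft e']]; exists (s ++ t); split; first exact/forall_In_cat.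
apply: (eq_by_cases L (a := d)); rewrite ?(doms_antis L k0) in e' *;
  rewrite -!(restrict_antis k0 L) !restrict_cat.
  by rewrite e'.
by rewrite !(restrict_comm k0 L s) e.
Qed.

(** The sets modulo which b and c disagree are closed under unions of chains
    because agreement uses finitely many tests; a maximal one must decide every
    d, for otherwise b and c would agree after adding d and after adding A_k d
    as well. *)
Lemma prime_separation (b c : A) :
  b <> c -> exists F : set A, prime k0 F /\ ~ agree F b c.
Proof.
move=> bc; pose P (F : set A) := ~ agree F b c.
have [C CP Ctot | F [nF Fmax]] := @Zorn_bigcup A P.
  case=> s [Cs e].
  have [sE | [G [CG Gs]]] : s = [::] \/
      exists G, C G /\ forall a, List.In a s -> G a.
    elim: s Cs {e} => [|a s IHs]; first by left.
    case/forall_In_cons=> -[G CG Ga] Cs; right.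
    have [-> | [H [CH Hs]]] := IHs Cs.
      by exists G; split=> // _ [<-|[]].
    have [GH | HG] := Ctot _ _ CG CH.
      by exists H; split=> //; apply/forall_In_cons; split=> //; exact: GH.
    by exists G; split=> //; apply/forall_In_cons; split=> // q /Hs /HG.
  - by rewrite sE in e.
  - by apply: (CP G CG); exists s.
exists F; split=> // d.
have add d' : ~ F d' -> agree F (antis d' ;; b) (antis d' ;; c).
  move=> nFd; apply: agree_add; apply: contrapT; apply: Fmax; split.
    by move=> x Fx; left.
  by move=> FF; apply: nFd; apply: FF; right.
apply: contrapT => nd; apply: nF; apply: (agree_cases (d := d)).
  by apply: add => Fd; apply: nd; left.
by rewrite (doms_antis L k0); apply: add => Fd; apply: nd; right.
Qed.

End Separation.

(** * The representation *)

Section Representation.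
Variables (n : nat) (k0 : 'I_n) (A : algebra n) (o : A) (L : laws o).

(** A point remembers its prime set, so that the points of different prime sets
    are disjoint; the class is a set of elements, which avoids a quotient type.
    A prime set need not be proper, but an improper one has no element that is
    alive and so contributes no point. *)
Record point := Point {
  tests : set A;
  germ : set A;
  pointP : prime k0 tests /\
    exists a, ~ dead o tests a /\ germ = agree tests a }.

Lemma tests_prime (x : point) : prime k0 (tests x).
Proof. by case: (pointP x). Qed.

Lemma germ_inhabited (x : point) : exists a, germ x a.
Proof. by have [_ [a [_ ->]]] := pointP x; exists a; exact: agree_refl. Qed.

Lemma germ_alive (x : point) a : germ x a -> ~ dead o (tests x) a.
Proof.
have [_ [b [nb ->]]] := pointP x => ba da; apply: nb.
exact: (agree_dead k0 L (agree_sym ba) da).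
Qed.

Lemma germ_agree (x : point) a b : germ x a -> germ x b -> agree (tests x) a b.
Proof.
have [_ [c [_ ->]]] := pointP x => ca cb.
exact: (agree_trans k0 L (agree_sym ca) cb).
Qed.

Lemma agree_germ (x : point) a b : agree (tests x) a b -> germ x a -> germ x b.
Proof.
have [_ [c [_ ->]]] := pointP x => ab ca.
exact: (agree_trans k0 L ca ab).
Qed.

Lemma point_eq (x y : point) a :
  tests x = tests y -> germ x a -> germ y a -> x = y.
Proof.
move=> Fxy xa ya; have : germ x = germ y.
  apply/predeqP => b; split=> H.
    by apply: agree_germ ya; rewrite -Fxy; exact: germ_agree xa H.
  by apply: agree_germ xa; rewrite Fxy; exact: germ_agree ya H.
case: x y Fxy {xa ya} => F c p [G d q] /= FG cd.
by move: q; rewrite -FG -cd => q; congr Point; exact: Prop_irrelevance.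
Qed.

Lemma point_of (F : set A) a : prime k0 F -> ~ dead o F a ->
  exists x : point, tests x = F /\ germ x a.
Proof.
move=> prF na.
have H : prime k0 F /\ exists b, ~ dead o F b /\ agree F a = agree F b.
  by split=> //; exists a.
by exists (Point H); split=> //; exact: agree_refl.
Qed.

Definition same_tests (x y : point) : Prop := tests x = tests y.

Lemma same_tests_equiv : Equivalence same_tests.
Proof.
by split=> [x | x y | x y z]; rewrite /same_tests // => ->.
Qed.

(** Right translation of classes by f.  The value is undefined when a ; f is
    dead, because every member of a point is alive. *)
Definition repr (f : A) : graph n point :=
  [set p | [/\ forall i, same_tests (p.1 i) p.2
    & exists a : 'I_n -> A,
        (forall i, germ (p.1 i) (a i)) /\ germ p.2 (a ;; f)]]%classic.

(** Independence of the representatives chosen for the arguments. *)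
Lemma reprP (f : A) (x : 'I_n -> point) z (a : 'I_n -> A) :
  (forall i, germ (x i) (a i)) ->
  repr f (x, z) <->
  (forall i, tests (x i) = tests z) /\ germ z (a ;; f).
Proof.
move=> xa; split=> [[/= xz [b [xb zb]]] | [xz za]].
  split=> //; apply: agree_germ zb; apply: (agree_comp k0 L) => i.
  by rewrite -(xz i); exact: germ_agree.
by split=> //; exists a.
Qed.

Lemma germs (x : 'I_n -> point) :
  exists a : 'I_n -> A, forall i, germ (x i) (a i).
Proof.
by have [a xa] := choice (fun i => germ_inhabited (x i)); exists a.
Qed.

(** If a ; f is alive, its class is the missing value. *)
Lemma repr_undefined (f : A) (x : 'I_n -> point) (a : 'I_n -> A) :
  (forall i, germ (x i) (a i)) -> all_equiv same_tests x ->
  undefined_at (repr f) x <-> dead o (tests (x k0)) (a ;; f).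
Proof.
move=> xa Ex; split.
  move=> nf; apply: contrapT => naf; apply: nf.
  have [z [zF za]] := point_of (tests_prime (x k0)) naf.
  by exists z; apply/(reprP _ _ xa); split=> // i; rewrite zF; exact: Ex.
move=> da [z /(reprP _ _ xa) [xz /germ_alive]]; apply.
by rewrite -(xz k0).
Qed.

Lemma repr_pfun f : is_pfun (repr f).
Proof.
move=> x y z fy; have [a xa] := germs x.
have [xy ya] := (reprP f y xa).1 fy.
move=> /(reprP f z xa) [xz za]; apply: point_eq ya za.
by rewrite -(xy k0) -(xz k0).
Qed.

Lemma repr_equiv f x y : repr f (x, y) ->
  all_equiv same_tests x /\ (forall i, same_tests (x i) y).
Proof.
by case=> /= xy _; split=> // i j; rewrite /same_tests (xy i) (xy j).
Qed.

Lemma repr_comp (a : 'I_n -> A) f :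
  repr (a ;; f) = graph_comp (fun i => repr (a i)) (repr f).
Proof.
apply/predeqP => -[x z]; have [c xc] := germs x; split.
  move=> /(reprP _ _ xc) [xz]; rewrite -(comp_assoc L) => zc.
  have nc i : ~ dead o (tests z) (c ;; a i).
    move=> d; apply: (germ_alive zc).
    by apply: (dead_comp L _ (i := i)).
  have /choice [y yP] : forall i, exists y,
      tests y = tests z /\ germ y (c ;; a i).
    by move=> i; exact: point_of (tests_prime z) (nc i).
  exists y; split=> [i | ] /=.
    have [yz yi] := yP i.
    by apply/(reprP _ _ xc); split=> // j; rewrite yz xz.
  have yc i : germ (y i) (c ;; a i) by case: (yP i).
  by apply/(reprP _ _ yc); split=> // i; case: (yP i).
case=> y [/= xy yz].
have yc i : germ (y i) (c ;; a i) by case/(reprP _ _ xc): (xy i).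
move/(reprP _ _ yc): yz => [yz zc].
apply/(reprP _ _ xc); rewrite -(comp_assoc L); split=> // i.
by rewrite -(yz k0); case/(reprP _ _ xc): (xy k0).
Qed.

Lemma repr_antidom i f :
  repr (antidom i f) = graph_antidom same_tests i (repr f).
Proof.
apply/predeqP => -[x z]; have [a xa] := germs x; split.
  move=> H; have [xz za] := (reprP _ _ xa).1 H.
  have [Ex _] := repr_equiv H.
  have daf : dead o (tests z) (a ;; f).
    apply: contrapT => naf; apply: (germ_alive za).
    exact: (alive_comp_antidom L (tests_prime z)).
  split=> //=; last by apply/(repr_undefined _ xa Ex); rewrite xz.
  apply: (point_eq (a := a i)) => //.
  apply: agree_germ za; apply: (dead_comp_antidom L (tests_prime z)) daf => j.
  by rewrite -(xz j); exact: germ_alive.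
case=> /= -> Ex /(repr_undefined _ xa Ex); rewrite (Ex k0 i) => daf.
apply/(reprP _ _ xa); split=> [j|]; first exact: Ex.
apply: agree_germ (xa i); apply: agree_sym.
apply: (dead_comp_antidom L (tests_prime (x i))) daf => j.
by rewrite (Ex i j); exact: germ_alive.
Qed.

Lemma repr_fixset i f : repr (fixset i f) = graph_fixset i (repr f).
Proof.
apply/predeqP => -[x z]; have [a xa] := germs x; split.
  move=> H; have [xz za] := (reprP _ _ xa).1 H.
  have [af ai] := alive_comp_fixset L (tests_prime z) (germ_alive za).
  have zxi : z = x i.
    by apply: (point_eq (a := a i)) => //; exact: agree_germ za.
  split=> //=; rewrite -zxi; apply/(reprP _ _ xa); split=> //.
  exact: agree_germ za.
case=> /= -> /(reprP _ _ xa) [xxi af].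
apply/(reprP _ _ xa); split=> //.
apply: agree_germ (xa i); apply: agree_sym; apply: (agree_comp_fixset L).
exact: germ_agree.
Qed.

Lemma repr_punion f g : repr (punion f g) = graph_punion (repr f) (repr g).
Proof.
apply/predeqP => -[x z]; have [a xa] := germs x.
have alive : all_equiv same_tests x -> forall j, ~ dead o (tests (x k0)) (a j).
  by move=> Ex j; rewrite (Ex k0 j); exact: germ_alive.
split.
  move=> H; have [xz za] := (reprP _ _ xa).1 H; have [Ex _] := repr_equiv H.
  have [daf | naf] := EM (dead o (tests (x k0)) (a ;; f)); [right | left].
    split; first exact/(repr_undefined _ xa Ex).
    apply/(reprP _ _ xa); split=> //; apply: agree_germ za; rewrite -(xz k0).
    exact: (dead_comp_punion L (tests_prime _) _ (alive Ex)).
  apply/(reprP _ _ xa); split=> //; apply: agree_germ za; rewrite -(xz k0).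
  exact: (alive_comp_punion L (tests_prime _)).
case=> [H | [nf H]].
  have [xz za] := (reprP _ _ xa).1 H; have naf := germ_alive za.
  apply/(reprP _ _ xa); split=> //; apply: agree_germ za; apply: agree_sym.
  exact: (alive_comp_punion L (tests_prime _)).
have [Ex _] := repr_equiv H; have [xz za] := (reprP _ _ xa).1 H.
move/(repr_undefined _ xa Ex): nf => daf.
apply/(reprP _ _ xa); split=> //; apply: agree_germ za; apply: agree_sym.
rewrite -(xz k0).
exact: (dead_comp_punion L (tests_prime _) _ (alive Ex)).
Qed.

(** At the tuple of classes of pi_1, ..., pi_n of a separating prime set, the
    function of f takes the class of pi ; f = f as value. *)
Lemma repr_inj : injective repr.
Proof.
move=> b c bc; apply: contrapT => /(prime_separation k0 L) [F [prF nbc]].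
have key f g : ~ dead o F f -> repr f = repr g -> agree F f g.
  move=> nf fg.
  (* pi_i is alive, since otherwise f = pi ; f would be dead. *)
  have np i : ~ dead o F (antis o i).
    move=> d; apply: nf; rewrite -(proj_comp L f).
    exact: (dead_comp L _ (i := i)).
  have /choice [x xP] : forall i, exists y, tests y = F /\ germ y (antis o i).
    by move=> i; exact: point_of.
  have [z [zF zf]] := point_of prF nf.
  have xp i : germ (x i) (antis o i) by case: (xP i).
  have : repr f (x, z).
    apply/(reprP _ _ xp); rewrite (proj_comp L); split=> // i.
    by rewrite zF; case: (xP i).
  rewrite fg => /(reprP _ _ xp) [_]; rewrite (proj_comp L) => zg.
  by rewrite -zF; exact: germ_agree.
have [db | nb] := EM (dead o F b); last by apply: nbc; exact: key.
have [dc | nc] := EM (dead o F c).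
  by apply: nbc; exact: (agree_trans k0 L db (agree_sym dc)).
by apply: nbc; apply/agree_sym/key.
Qed.

Lemma laws_representable : representable A.
Proof.
pose elts : set (graph n point) := [set g | exists f, repr f = g]%classic.
have eltsR f : elts (repr f) by exists f.
have elts_comp f g : (forall i, elts (f i)) -> elts g -> elts (graph_comp f g).
  move=> /choice [a aP] [b <-]; exists (a ;; b); rewrite repr_comp.
  by congr graph_comp; apply/funext.
have elts_antidom i f : elts f -> elts (graph_antidom same_tests i f).
  by case=> a <-; exists (antidom i a); exact: repr_antidom.
have elts_fixset i f : elts f -> elts (graph_fixset i f).
  by case=> a <-; exists (fixset i a); exact: repr_fixset.
have elts_punion f g : elts f -> elts g -> elts (graph_punion f g).
  by case=> a <- [b <-]; exists (punion a b); exact: repr_punion.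
have elts_nonempty : exists f, elts f by exists (repr o).
have elts_pfun f : elts f -> is_pfun f by case=> a <-; exact: repr_pfun.
have elts_rel f : elts f -> forall x y, f (x, y) ->
    all_equiv same_tests x /\ (forall i, same_tests (x i) y).
  by case=> a <-; exact: repr_equiv.
exists (PfunAlgebra same_tests_equiv elts_nonempty elts_pfun elts_rel
  elts_comp elts_antidom elts_fixset elts_punion).
exists (fun f => exist _ (repr f) (eltsR f)); split.
  split=> *; apply: eq_exist; [exact: repr_comp | exact: repr_antidom
    | exact: repr_fixset | exact: repr_punion].
have /choice [inv invP] : forall g : {g | elts g}, exists f, repr f = sval g.
  by case=> g [f fg]; exists f.
exists inv => [f | [g eg]]; first by apply: repr_inj; rewrite invP.
by apply: eq_exist; rewrite invP.
Qed.

End Representation.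

Theorem theorem8p6 (n : nat) (hn : 1 <= n) :
  quasivariety (@representable n) /\
  finitely_axiomatised_by (@representable n) (axioms n).
Proof.
suff H : finitely_axiomatised_by (@representable n) (axioms n).
  by split=> //; eexists; exact: H.
move=> A; split; first exact: representable_satisfies.
by case/satisfies_axiomsP=> o L; exact: (laws_representable (Ordinal hn) L).
Qed.
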